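(* Let $(M^{2n+1},g)$ be a Riemannian manifold admitting a unit Killing vector field $\xi$ such that the $\xi$-sectional curvature is positive, i.e., every plane in a tangent space of $M$ that contains $\xi$ has positive sectional curvature. Then $M(\varphi,Q,\xi,\eta,g)$ is a weak $K$-contact manifold with the following structural tensors: $\eta(X)=g(X,\xi)$ and $\varphi X=-\nabla_X\,\xi$ for all $X$, $QX=R_{X,\xi}\,\xi$ for $X\in\ker\eta$, and $Q\xi=\xi$.
   Context: $\nabla$ is the Levi-Civita connection of $g$ and $R_{X,Y}Z=\nabla_X\nabla_YZ-\nabla_Y\nabla_XZ-\nabla_{[X,Y]}Z$ is the curvature tensor. A weak almost contact structure on a smooth manifold $M^{2n+1}$ is a set $(\varphi,Q,\xi,\eta)$, where $\varphi$ is a $(1,1)$-tensor field, $Q$ is a nonsingular $(1,1)$-tensor field, $\xi$ is a vector field (the Reeb vector field) and $\eta$ is a 1-form with $\eta(\xi)=1$, satisfying $\varphi^2=-Q+\eta\otimes\xi$ and $Q\xi=\xi$; moreover, the distribution $\mathcal D=\ker\eta$ is assumed to be $\varphi$-invariant ($\varphi X\in\mathcal D$ for $X\in\mathcal D$). A weak almost contact metric structure $(\varphi,Q,\xi,\eta,g)$ is a weak almost contact structure together with a Riemannian metric $g$ such that $g(\varphi X,\varphi Y)=g(X,QY)-\eta(X)\eta(Y)$ for all vector fields $X,Y$. A weak contact metric structure is a weak almost contact metric structure such that $\Phi=d\eta$, where $\Phi(X,Y)=g(X,\varphi Y)$ and $d\eta(X,Y)=\frac12\{X(\eta(Y))-Y(\eta(X))-\eta([X,Y])\}$.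 A weak $K$-contact manifold is a weak contact metric manifold whose Reeb vector field $\xi$ is Killing, i.e., $\mathcal L_\xi g=0$. *)

(* Defs.v *)
From HB Require Import structures.
From mathcomp Require Import all_boot all_order all_algebra.
From mathcomp Require Import all_classical all_reals all_analysis.
From mathcomp Require Import ring.
Import numFieldNormedType.Exports.
Import Order.TTheory GRing.Theory Num.Theory.

Set Implicit Arguments.
Unset Strict Implicit.
Unset Printing Implicit Defensive.

Local Open Scope classical_set_scope.
Local Open Scope ring_scope.

(** Smooth functions on open subsets of R^m *)

Section Smooth_on.
Context {R : realType} {m : nat}.
Implicit Types (U : set 'rV[R]_m) (f g : 'rV[R]_m -> R^o).

(* C^k on U (meant for U open): all partial derivatives of order at most k
   exist and are continuous at every point of U. *)
Fixpoint Ck_on (k : nat) U f : Prop :=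
  (forall x, U x -> {for x, continuous f}) /\
  (if k is k'.+1 then
     forall i : 'I_m, (forall x, U x -> derivable f x 'e_i) /\
                      Ck_on k' U (fun x => 'D_('e_i) f x)
   else True).

Definition smooth_on U f := forall k, Ck_on k U f.

Lemma Ck_onS k U f : Ck_on k.+1 U f -> Ck_on k U f.
Proof.
elim: k f => [|k IH] f; first by case.
case=> cf df; split=> // i; have [dfi sfi] := df i; split=> //; exact: IH.
Qed.

Lemma Ck_on_eq k U f g : open U -> (forall x, U x -> f x = g x) ->
  Ck_on k U f -> Ck_on k U g.
Proof.
move=> oU; have n_eq h1 h2 x : (forall y, U y -> h1 y = h2 y) -> U x ->
    \forall y \near x, h1 y = h2 y :> R.
  by move=> h12 Ux; near=> y; apply: h12; near: y; exact: open_nbhs_nbhs.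
have c_eq h1 h2 : (forall y, U y -> h1 y = h2 y) ->
    (forall x, U x -> {for x, continuous (h1 : _ -> R^o)}) ->
    forall x, U x -> {for x, continuous (h2 : _ -> R^o)}.
  move=> h12 ch x Ux; move: (ch x Ux).
  rewrite /prop_for /continuous_at -(h12 _ Ux); apply: cvg_trans.
  exact: (near_eq_cvg (n_eq _ _ _ h12 Ux)).
elim: k f g => [|k IH] f g fg /= [cf df]; split=> //; try exact: c_eq cf.
move=> i; have [dfi sfi] := df i; split=> [x Ux|].
  exact: (near_eq_derivable (n_eq f g x fg Ux) (dfi _ Ux)).
apply: IH sfi => x Ux; exact: (near_eq_derive _ (n_eq f g x fg Ux)).
Unshelve. all: by end_near. Qed.

Lemma Ck_on_cst k U (c : R) : open U -> Ck_on k U (fun=> c).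
Proof.
move=> oU; elim: k c => [|k IH] c; (split; [move=> x _|]) => //;
  try exact: cst_continuous; move=> i.
split=> [x _|]; first exact: derivable_cst.
by apply: Ck_on_eq (IH 0) => // x _; rewrite derive_cst.
Qed.

Lemma Ck_onD k U f g : open U -> Ck_on k U f -> Ck_on k U g ->
  Ck_on k U (fun x => f x + g x).
Proof.
move=> oU; elim: k f g => [|k IH] f g [cf df] [cg dg].
  split=> // x Ux; exact: (continuousD (cf x Ux) (cg x Ux)).
split=> [x Ux|i]; first exact: (continuousD (cf x Ux) (cg x Ux)).
have [df1 df2] := df i; have [dg1 dg2] := dg i.
split=> [x Ux|]; first exact: (derivableD (df1 x Ux) (dg1 x Ux)).
apply: Ck_on_eq (IH _ _ df2 dg2) => // x Ux.
by rewrite -(deriveD (df1 x Ux) (dg1 x Ux)).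
Qed.

Lemma Ck_onM k U f g : open U -> Ck_on k U f -> Ck_on k U g ->
  Ck_on k U (fun x => (f x : R) * g x).
Proof.
move=> oU; elim: k f g => [|k IH] f g Hf Hg.
  split=> // x Ux; case: Hf Hg => cf _ [cg _].
  exact: (@continuousM _ _ f g x (cf x Ux) (cg x Ux)).
have [cf df] := Hf; have [cg dg] := Hg.
split=> [x Ux|i]; first exact: (@continuousM _ _ f g x (cf x Ux) (cg x Ux)).
have [df1 df2] := df i; have [dg1 dg2] := dg i.
split=> [x Ux|].
  exact: (@derivableM _ _ f g x _ (df1 x Ux) (dg1 x Ux)).
apply: Ck_on_eq (Ck_onD oU (IH _ _ (Ck_onS Hf) dg2) (IH _ _ (Ck_onS Hg) df2)) => //.
move=> x Ux; symmetry.
exact: (@deriveM _ _ f g x _ (df1 x Ux) (dg1 x Ux)).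
Qed.

End Smooth_on.

(** Smooth manifolds *)

(* A chart is a homeomorphism, with inverse [chart_inv], from the open set
   [chart_dom] onto an open subset [chart_cod] of R^m; the values of
   [chart_map] and [chart_inv] outside of these sets are irrelevant. *)
Record chart (R : realType) (m : nat) (T : topologicalType) := Chart {
  chart_dom : set T;
  chart_cod : set 'rV[R]_m;
  chart_map : T -> 'rV[R]_m;
  chart_inv : 'rV[R]_m -> T;
  chart_dom_open : open chart_dom;
  chart_cod_open : open chart_cod;
  chart_map_cod : forall p, chart_dom p -> chart_cod (chart_map p);
  chart_inv_dom : forall x, chart_cod x -> chart_dom (chart_inv x);
  chart_mapK : forall p, chart_dom p -> chart_inv (chart_map p) = p;
  chart_invK : forall x, chart_cod x -> chart_map (chart_inv x) = x;
  chart_map_continuous : forall p, chart_dom p -> {for p, continuous chart_map};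
  chart_inv_continuous : forall x, chart_cod x -> {for x, continuous chart_inv}
}.

(* The transition map d o c^-1 is smooth, componentwise, on the image under c
   of the overlap of the two chart domains. *)
Definition smooth_transition (R : realType) (m : nat) (T : topologicalType)
    (c d : chart R m T) : Prop :=
  forall j : 'I_m,
    smooth_on (chart_cod c `&` chart_inv c @^-1` chart_dom d)
              (fun x => chart_map d (chart_inv c x) ord0 j : R^o).

(* The atlas need not be maximal: an atlas determines the smooth structure. *)
Record smoothManifold (R : realType) (m : nat) := SmoothManifold {
  carrier :> topologicalType;
  manifold_hausdorff : hausdorff_space carrier;
  manifold_second_countable : @second_countable carrier;
  atlas : set (chart R m carrier);
  atlas_cover : forall p : carrier, exists2 c, atlas c & chart_dom c p;
  atlas_compatible : forall c d, atlas c -> atlas d -> smooth_transition c d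
}.

(** The algebra C^oo(M) *)

Section SmoothFunctions.
Context {R : realType} {m : nat} (M : smoothManifold R m).

Definition is_smooth (f : M -> R) : Prop :=
  forall c, atlas c ->
    smooth_on (chart_cod c) (fun x => f (chart_inv c x) : R^o).

Definition smooth_pred : {pred M -> R^o} := fun f => `[< is_smooth f >].

Lemma smooth_predP f : reflect (is_smooth f) (f \in smooth_pred).
Proof. exact: asboolP. Qed.

Fact smooth_subring : subring_closed smooth_pred.
Proof.
have sc (c : R) : is_smooth (fun=> c).
  by move=> d _ k; apply: Ck_on_cst; exact: chart_cod_open.
have sM f g : is_smooth f -> is_smooth g -> is_smooth (fun x => f x * g x).
  move=> sf sg d ad k; apply: Ck_onM; first exact: chart_cod_open.
    exact: sf.
  exact: sg.
split; first by apply/smooth_predP; exact: sc.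
  move=> f g /smooth_predP sf /smooth_predP sg; apply/smooth_predP.
  have -> : f - g = (fun x => f x + (- 1) * g x).
    by apply/funext => x; rewrite mulN1r.
  move=> d ad k; apply: Ck_onD; [exact: chart_cod_open|exact: sf|].
  exact: (sM _ _ (sc (- 1)) sg).
move=> f g /smooth_predP sf /smooth_predP sg; apply/smooth_predP; exact: sM.
Qed.

Fact smooth_submod : submod_closed smooth_pred.
Proof.
have [s1 sB sM] := smooth_subring.
have s0 : 0 \in smooth_pred by rewrite -(subrr 1); exact: sB.
split=> // a f g sf sg.
have sa : (fun=> a) \in smooth_pred.
  apply/smooth_predP => d _ k; apply: Ck_on_cst; exact: chart_cod_open.
rewrite -[g]opprK; apply: (sB (a *: f) (- g)).
  exact: (sM (fun=> a) f).
by rewrite -sub0r; exact: sB.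
Qed.

HB.instance Definition _ :=
  GRing.isSubringClosed.Build (M -> R^o) smooth_pred smooth_subring.
HB.instance Definition _ :=
  GRing.isSubmodClosed.Build R (M -> R^o) smooth_pred smooth_submod.

Record smoothFun := SmoothFun {
  sfun_val :> M -> R^o;
  sfun_smooth : sfun_val \in smooth_pred
}.

HB.instance Definition _ := [isSub for sfun_val].
HB.instance Definition _ := [Choice of smoothFun by <:].
HB.instance Definition _ :=
  GRing.SubChoice_isSubComPzRing.Build _ _ smoothFun (subringClosedP _).
HB.instance Definition _ := [SubZmodule_isSubLmodule of smoothFun by <:].

Lemma smooth_scalerAr (a : R) (f g : smoothFun) : f * (a *: g) = a *: (f * g).
Proof.
apply/val_inj/funext => p.
by rewrite -[LHS]/(f p * (a * g p)) -[RHS]/(a * (f p * g p)) mulrCA.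
Qed.

End SmoothFunctions.
Arguments smooth_pred {R m} M _.

Notation "'C^oo' ( M )" := (smoothFun M)
  (at level 0, format "'C^oo' ( M )") : type_scope.

(** Tangent vectors: R-linear derivations of C^oo(M) at a point *)

Section Tangent.
Context {R : realType} {m : nat} {M : smoothManifold R m} (p : M).

Definition is_point_derivation (v : C^oo(M) -> R^o) : Prop :=
  linear v /\ (forall f g : C^oo(M), v (f * g) = f p * v g + v f * g p).

Definition point_derivation_pred : {pred C^oo(M) -> R^o} :=
  fun v => `[< is_point_derivation v >].

Fact point_derivation_submod : submod_closed point_derivation_pred.
Proof.
split.
  apply/asboolP; split=> [a f g|f g] /=; first by rewrite scaler0 addr0.
  by rewrite mulr0 mul0r addr0.
move=> a v w /asboolP[vl vM] /asboolP[wl wM]; apply/asboolP.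
split=> [b f g|f g].
  have E (b' x y z t : R) :
    a * (b' * x + y) + (b' * z + t) = b' * (a * x + z) + (a * y + t) by ring.
  by rewrite -[LHS]/(a * v (b *: f + g) + w (b *: f + g)) vl wl; exact: E.
have E (f' g' x y z t : R) : a * (f' * x + y * g') + (f' * z + t * g') =
  f' * (a * x + z) + (a * y + t) * g' by ring.
by rewrite -[LHS]/(a * v (f * g) + w (f * g)) vM wM; exact: E.
Qed.

HB.instance Definition _ := GRing.isSubmodClosed.Build R (C^oo(M) -> R^o)
  point_derivation_pred point_derivation_submod.

Record tangent := Tangent {
  tangent_val :> C^oo(M) -> R^o;
  tangentP : tangent_val \in point_derivation_pred
}.

HB.instance Definition _ := [isSub for tangent_val].
HB.instance Definition _ := [Choice of tangent by <:].
HB.instance Definition _ := [SubChoice_isSubZmodule of tangent by <:].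
HB.instance Definition _ := [SubZmodule_isSubLmodule of tangent by <:].

End Tangent.

(** Vector fields *)

(* A smooth vector field is a family (X_p) of tangent vectors such that
   X f : p |-> X_p f is smooth for every smooth f. Such a family is the same
   thing as an R-linear derivation f |-> X f of C^oo(M), which is the encoding
   used here; X_p is recovered below as [vf_at p X]. *)
Section VectorFields.
Context {R : realType} {m : nat} (M : smoothManifold R m).

Definition is_derivation (D : C^oo(M) -> (C^oo(M))^o) : Prop :=
  (forall (a : R) (f g : C^oo(M)), D (a *: f + g) = (a *: D f + D g :> C^oo(M))) /\
  (forall f g : C^oo(M), D (f * g) = (f * D g + D f * g :> C^oo(M))).

Definition derivation_pred : {pred C^oo(M) -> (C^oo(M))^o} :=
  fun D => `[< is_derivation D >].

Fact derivation_submod : submod_closed derivation_pred.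
Proof.
split.
  apply/asboolP; split=> [a f g|f g].
    by apply/val_inj/funext => p; rewrite /= scaler0 addr0.
  by rewrite mulr0 mul0r addr0.
move=> h v w /asboolP[vl vM] /asboolP[wl wM]; apply/asboolP.
have E f : (h *: v + w) f = (h * v f + w f :> C^oo(M)) by [].
split=> [b f g|f g]; rewrite !E.
  have F (b' : R) (h' x y z t : C^oo(M)) :
    h' * (b' *: x + y) + (b' *: z + t) = b' *: (h' * x + z) + (h' * y + t).
    by rewrite mulrDr smooth_scalerAr scalerDr addrACA.
  by rewrite vl wl; exact: F.
have F (h' f' g' x y z t : C^oo(M)) :
  h' * (f' * x + y * g') + (f' * z + t * g') =
  f' * (h' * x + z) + (h' * y + t) * g'.
  by rewrite !mulrDr mulrDl !mulrA [f' * h']mulrC addrACA.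
by rewrite vM wM; exact: F.
Qed.

HB.instance Definition _ := GRing.isSubmodClosed.Build (C^oo(M))
  (C^oo(M) -> (C^oo(M))^o) derivation_pred derivation_submod.

Record vectorField := VectorField {
  vf_val :> C^oo(M) -> (C^oo(M))^o;
  vfP : vf_val \in derivation_pred
}.

(* Vector fields form a module over C^oo(M). *)
HB.instance Definition _ := [isSub for vf_val].
HB.instance Definition _ := [Choice of vectorField by <:].
HB.instance Definition _ := [SubChoice_isSubZmodule of vectorField by <:].
HB.instance Definition _ := [SubZmodule_isSubLmodule of vectorField by <:].

End VectorFields.
Arguments vectorField {R m} M.
Arguments derivation_pred {R m} M _.


Section VectorFieldOperations.
Context {R : realType} {m : nat} {M : smoothManifold R m}.
Implicit Types X Y : vectorField M.

Fact vf_at_subproof (p : M) X :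
  (fun f : C^oo(M) => (X f : C^oo(M)) p : R^o) \in point_derivation_pred p.
Proof.
have /asboolP[Xl XM] := vfP X.
apply/asboolP; split=> [a f g|f g]; last by rewrite XM.
by rewrite Xl.
Qed.

Definition vf_at (p : M) X : tangent p := Tangent (vf_at_subproof p X).

Fact lie_bracket_subproof X Y :
  (fun f : C^oo(M) => (X (Y f) : C^oo(M)) - Y (X f) : (C^oo(M))^o)
    \in derivation_pred M.
Proof.
have /asboolP[Xl XM] := vfP X; have /asboolP[Yl YM] := vfP Y.
have XD (f g : C^oo(M)) : X (f + g) = (X f + X g :> C^oo(M)).
  by have := Xl 1 f g; rewrite !scale1r.
have YD (f g : C^oo(M)) : Y (f + g) = (Y f + Y g :> C^oo(M)).
  by have := Yl 1 f g; rewrite !scale1r.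
apply/asboolP; split=> [a f g|f g].
  have F (b : R) (x y z t : C^oo(M)) :
    b *: x + y - (b *: z + t) = b *: (x - z) + (y - t).
    by rewrite scalerBr opprD addrACA.
  by rewrite Xl Yl Xl Yl; exact: F.
have F (f0 g0 xf yf xg yg xyf yxf xyg yxg : C^oo(M)) :
  f0 * xyg + xf * yg + (yf * xg + xyf * g0) -
  (f0 * yxg + yf * xg + (xf * yg + yxf * g0)) =
  f0 * (xyg - yxg) + (xyf - yxf) * g0 by ring.
by rewrite XM YM XD YD !XM !YM; exact: F.
Qed.

(* [X, Y] f = X (Y f) - Y (X f) *)
Definition lie_bracket X Y : vectorField M :=
  VectorField (lie_bracket_subproof X Y).

End VectorFieldOperations.

(** Riemannian metrics, Levi-Civita connection and curvature *)

Record riemannianMetric (R : realType) (m : nat) (M : smoothManifold R m) :=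
  RiemannianMetric {
    metric_at : forall p : M, tangent p -> tangent p -> R;
    metric_linear : forall (p : M) (a : R) (u v w : tangent p),
      metric_at (a *: u + v) w = a * metric_at u w + metric_at v w;
    metric_sym : forall (p : M) (u v : tangent p),
      metric_at u v = metric_at v u;
    metric_pos : forall (p : M) (u : tangent p), u != 0 -> 0 < metric_at u u;
    metric_smooth : forall X Y : vectorField M,
      (fun p => metric_at (vf_at p X) (vf_at p Y) : R^o) \in smooth_pred M
  }.

Section Riemannian.
Context {R : realType} {m : nat} {M : smoothManifold R m}.
Variable g : riemannianMetric M.
Implicit Types (X Y Z : vectorField M) (f : C^oo(M)).

(* the smooth function g(X, Y) *)
Definition metric X Y : C^oo(M) := SmoothFun (metric_smooth g X Y).

Definition is_connection (nabla : vectorField M -> vectorField M -> vectorField M)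
    : Prop :=
  [/\ forall f X Y Z, nabla (f *: X + Y) Z = f *: nabla X Z + nabla Y Z,
      forall X Y Z, nabla X (Y + Z) = nabla X Y + nabla X Z &
      forall X f Y, nabla X (f *: Y) = (X f : C^oo(M)) *: Y + f *: nabla X Y].

(* By the fundamental theorem of Riemannian geometry exactly one [nabla]
   satisfies this predicate. *)
Definition is_levi_civita
    (nabla : vectorField M -> vectorField M -> vectorField M) : Prop :=
  [/\ is_connection nabla,
      forall X Y, nabla X Y - nabla Y X = lie_bracket X Y &
      forall X Y Z,
        X (metric Y Z) = (metric (nabla X Y) Z + metric Y (nabla X Z) :> C^oo(M))].

(* (L_X g)(Y, Z) *)
Definition lie_metric X Y Z : C^oo(M) :=
  (X (metric Y Z) : C^oo(M)) - metric (lie_bracket X Y) Z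
    - metric Y (lie_bracket X Z).

Definition killing X : Prop := forall Y Z, lie_metric X Y Z = 0.

Variable nabla : vectorField M -> vectorField M -> vectorField M.

Definition curvature X Y Z : vectorField M :=
  nabla X (nabla Y Z) - nabla Y (nabla X Z) - nabla (lie_bracket X Y) Z.

(* For X_p and Y_p linearly independent, the sectional curvature of the plane
   that they span; the curvature being a tensor field, the value depends on X
   and Y only through X_p and Y_p. *)
Definition sectional_curvature (p : M) X Y : R :=
  metric (curvature X Y Y) X p /
  (metric X X p * metric Y Y p - metric X Y p ^+ 2).

Definition linearly_independent (p : M) (u v : tangent p) : Prop :=
  forall a b : R, a *: u + b *: v = 0 -> a = 0 /\ b = 0.

(* Every plane in a tangent space that contains xi has positive sectional
   curvature; every tangent vector at p is of the form X_p. *)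
Definition positive_xi_sectional_curvature (xi : vectorField M) : Prop :=
  forall (p : M) X Y,
    linearly_independent (vf_at p X) (vf_at p Y) ->
    (exists a b : R, vf_at p xi = a *: vf_at p X + b *: vf_at p Y) ->
    0 < sectional_curvature p X Y.

End Riemannian.

(** Weak contact structures *)

(* (1,1)-tensor fields and 1-forms are C^oo(M)-linear maps on vector fields. *)
Notation endoField M := {linear vectorField M -> vectorField M}.
Notation oneForm M := {linear vectorField M -> (C^oo(M))^o}.

Section WeakContact.
Context {R : realType} {m : nat} {M : smoothManifold R m}.
Variables (phi Q : endoField M) (xi : vectorField M) (eta : oneForm M).
Variable g : riemannianMetric M.
Implicit Types X Y : vectorField M.

(* For every p the endomorphism Q_p : X_p |-> (Q X)_p of the (finite
   dimensional) tangent space at p has trivial kernel. *)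
Definition nonsingular : Prop :=
  forall (p : M) X, vf_at p (Q X) = 0 -> vf_at p X = 0.

Definition weak_almost_contact : Prop :=
  [/\ nonsingular,
      eta xi = (1 : C^oo(M)),
      forall X, phi (phi X) = - Q X + (eta X : C^oo(M)) *: xi,
      Q xi = xi &
      forall X, eta X = 0 -> eta (phi X) = 0].

Definition weak_almost_contact_metric : Prop :=
  weak_almost_contact /\
  forall X Y, metric g (phi X) (phi Y) = metric g X (Q Y) - (eta X : C^oo(M)) * eta Y.

Definition fundamental_form X Y : C^oo(M) := metric g X (phi Y).

Definition d_eta X Y : C^oo(M) :=
  (2^-1 : R) *: ((X (eta Y) : C^oo(M)) - Y (eta X) - eta (lie_bracket X Y)).

Definition weak_contact_metric : Prop :=
  weak_almost_contact_metric /\ forall X Y, fundamental_form X Y = d_eta X Y.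

Definition weak_K_contact : Prop := weak_contact_metric /\ killing g xi.

End WeakContact.

(* Main.v *)
(** A Killing field [xi] preserves the Levi-Civita connection, so
    [A X = nabla_X xi] satisfies [nabla_xi (A X) = A (nabla_xi X)].  As
    [nabla_xi xi = 0] for a unit Killing field, this gives
    [R(X, xi) xi = - A (A X)].  With [A] skew-adjoint, every identity required
    of the structure tensors is then algebraic; positivity of the curvatures
    is needed only for the nonsingularity of [Q]. *)
From HB Require Import structures.
Require Import Defs.
From mathcomp Require Import all_boot all_order all_algebra.
From mathcomp Require Import all_classical all_reals all_analysis.
From mathcomp Require Import ring.
Import numFieldNormedType.Exports.
Import Order.TTheory GRing.Theory Num.Theory.
Local Open Scope ring_scope.

(** * Vector fields as derivations and the algebra of the metric *)

Section Metric.
Context {R : realType} {m : nat} {M : smoothManifold R m}.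
Implicit Types (X Y Z : vectorField M) (f h : C^oo(M)).

Lemma double_eq0 f : f + f = 0 -> f = 0.
Proof.
move=> ff0; apply: (scalerI (a := 2%:R : R)); first by rewrite pnatr_eq0.
by rewrite scaler0 scaler_nat mulr2n.
Qed.

Lemma vfD X f h : X (f + h) = (X f + X h :> C^oo(M)).
Proof.
have /asboolP[Xl _] := vfP X.
by have := Xl 1 f h; rewrite !scale1r.
Qed.

Lemma vfN X f : X (- f) = (- (X f : C^oo(M)) :> C^oo(M)).
Proof.
have X0 : X 0 = (0 :> C^oo(M)).
  by apply: (@addrI _ (X 0 : C^oo(M))); rewrite -vfD !addr0.
by apply: (@addrI _ (X f : C^oo(M))); rewrite -vfD !subrr.
Qed.

Lemma vf1 X : X 1 = (0 :> C^oo(M)).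
Proof.
have /asboolP[_ XM] := vfP X.
have := XM 1 1; rewrite !mul1r mulr1 => /eqP.
by rewrite -subr_eq0 opprD addNKr oppr_eq0 => /eqP.
Qed.

Lemma vf_eqP X Y : (forall f, X f = (Y f :> C^oo(M))) -> X = Y.
Proof. by move=> XY; apply/val_inj/funext. Qed.

Lemma vf_at_linear (p : M) f X Y :
  vf_at p (f *: X + Y) = f p *: vf_at p X + vf_at p Y.
Proof. exact/val_inj. Qed.

Lemma vf_at_inj X Y : (forall p : M, vf_at p X = vf_at p Y) -> X = Y.
Proof.
move=> XY; apply: vf_eqP => f; apply/val_inj/funext => p.
by have := congr1 (fun v : tangent p => v f) (XY p).
Qed.

Lemma lie_bracketC X Y : lie_bracket Y X = - lie_bracket X Y.
Proof. by apply: vf_eqP => f; exact/esym/opprB. Qed.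

Lemma lie_bracketBr X Y Z :
  lie_bracket X (Y - Z) = lie_bracket X Y - lie_bracket X Z.
Proof.
apply: vf_eqP => f.
rewrite -[LHS]/((X ((Y f : C^oo(M)) - Z f) : C^oo(M))
  - ((Y (X f) : C^oo(M)) - Z (X f))).
rewrite -[RHS]/((X (Y f) : C^oo(M)) - Y (X f)
  - ((X (Z f) : C^oo(M)) - Z (X f))).
by rewrite vfD vfN !opprD addrACA.
Qed.

Lemma lie_bracket_jacobi X Y Z :
  lie_bracket X (lie_bracket Y Z) =
  lie_bracket (lie_bracket X Y) Z + lie_bracket Y (lie_bracket X Z).
Proof.
apply: vf_eqP => f.
pose br U V h : C^oo(M) := (U (V h) : C^oo(M)) - V (U h).
rewrite -[LHS]/((X (br Y Z f) : C^oo(M)) - br Y Z (X f)).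
rewrite -[RHS]/((br X Y (Z f) : C^oo(M)) - Z (br X Y f) +
  ((Y (br X Z f) : C^oo(M)) - br X Z (Y f))).
rewrite /br !vfD !vfN.
(* The six threefold derivatives of [f] become independent variables, and the identity is linear in
   them. *)
by move: (X (Y (Z f)) : C^oo(M)) (X (Z (Y f)) : C^oo(M))
  (Y (X (Z f)) : C^oo(M)) (Y (Z (X f)) : C^oo(M))
  (Z (X (Y f)) : C^oo(M)) (Z (Y (X f)) : C^oo(M)) => *; ring.
Qed.

Variable g : riemannianMetric M.
Local Notation gm := (metric g).

Lemma metricC X Y : gm X Y = gm Y X.
Proof. by apply/val_inj/funext => p; exact: Defs.metric_sym. Qed.

Lemma metric_linearl f X Y Z : gm (f *: X + Y) Z = f * gm X Z + gm Y Z.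
Proof.
apply/val_inj/funext => p.
by rewrite /= vf_at_linear metric_linear.
Qed.

Lemma metricDl X Y Z : gm (X + Y) Z = gm X Z + gm Y Z.
Proof. by have := metric_linearl 1 X Y Z; rewrite scale1r mul1r. Qed.

Lemma metric0l Z : gm 0 Z = 0.
Proof. by apply: (@addrI _ (gm 0 Z)); rewrite -metricDl !addr0. Qed.

Lemma metricZl f X Z : gm (f *: X) Z = f * gm X Z.
Proof. by have := metric_linearl f X 0 Z; rewrite metric0l !addr0. Qed.

Lemma metricNl X Z : gm (- X) Z = - gm X Z.
Proof. by rewrite -scaleN1r metricZl mulN1r. Qed.

Lemma metricBl X Y Z : gm (X - Y) Z = gm X Z - gm Y Z.
Proof. by rewrite metricDl metricNl. Qed.

Lemma metricDr X Y Z : gm Z (X + Y) = gm Z X + gm Z Y.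
Proof. by rewrite !(metricC Z) metricDl. Qed.

Lemma metricNr X Z : gm Z (- X) = - gm Z X.
Proof. by rewrite !(metricC Z) metricNl. Qed.

Lemma metricBr X Y Z : gm Z (X - Y) = gm Z X - gm Z Y.
Proof. by rewrite metricDr metricNr. Qed.

Lemma metricZr f X Z : gm Z (f *: X) = f * gm Z X.
Proof. by rewrite !(metricC Z) metricZl. Qed.

Lemma metric_at0l (p : M) (v : tangent p) : metric_at g 0 v = 0.
Proof.
have := metric_linear g 1 0 0 v.
by rewrite scale1r mul1r addr0 => /eqP; rewrite -subr_eq0 opprD addNKr oppr_eq0 => /eqP.
Qed.

(** Take [Z = X] and use positivity at each point. Equalities of vector fields can thus be tested by
    pairing with global fields. *)
Lemma metric_nondegenerate X : (forall Z, gm X Z = 0) -> X = 0.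
Proof.
move=> X0; apply: vf_at_inj => p.
have -> : vf_at p (0 : vectorField M) = 0 by exact/val_inj.
apply/eqP/negP => /negP Xp; have := Defs.metric_pos g Xp.
have := congr1 (fun h : C^oo(M) => h p) (X0 X) => /= ->.
by rewrite ltxx.
Qed.

Lemma metric_at_combination (p : M) (a b : R) (u v w : tangent p) :
  metric_at g (a *: u + b *: v) w = a * metric_at g u w + b * metric_at g v w.
Proof. by rewrite metric_linear -[b *: v]addr0 metric_linear metric_at0l addr0. Qed.

Lemma orthogonal_linearly_independent (p : M) (u v : tangent p) :
  u != 0 -> v != 0 -> metric_at g u v = 0 -> linearly_independent u v.
Proof.
move=> u0 v0 uv a b abuv.
have vu : metric_at g v u = 0 by rewrite Defs.metric_sym.
split.
  have := metric_at_combination p a b u v u.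
  rewrite abuv metric_at0l vu mulr0 addr0 => /esym/eqP.
  by rewrite mulf_eq0 [X in _ || X]gt_eqF ?orbF; [move/eqP | exact: Defs.metric_pos].
have := metric_at_combination p a b u v v.
rewrite abuv metric_at0l uv mulr0 add0r => /esym/eqP.
by rewrite mulf_eq0 [X in _ || X]gt_eqF ?orbF; [move/eqP | exact: Defs.metric_pos].
Qed.

End Metric.

(** * Killing fields, and unit Killing fields, under the Levi-Civita connection *)

Section Killing.
Context {R : realType} {m : nat} {M : smoothManifold R m}.
Variables (g : riemannianMetric M)
  (nabla : vectorField M -> vectorField M -> vectorField M).
Hypothesis hnabla : is_levi_civita g nabla.
Implicit Types (X Y Z : vectorField M) (f : C^oo(M)).
Local Notation gm := (metric g).

Lemma nablaDl X Y Z : nabla (X + Y) Z = nabla X Z + nabla Y Z.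
Proof.
have [[lin _ _] _ _] := hnabla.
by have := lin 1 X Y Z; rewrite !scale1r.
Qed.

Lemma nabla0l Z : nabla 0 Z = 0.
Proof. by apply: (@addrI _ (nabla 0 Z)); rewrite -nablaDl !addr0. Qed.

Lemma nablaNl X Z : nabla (- X) Z = - nabla X Z.
Proof. by apply: (@addrI _ (nabla X Z)); rewrite -nablaDl !subrr nabla0l. Qed.

Lemma nabla0r Z : nabla Z 0 = 0.
Proof.
have [[_ add _] _ _] := hnabla.
by apply: (@addrI _ (nabla Z 0)); rewrite -add !addr0.
Qed.

(** The form [T(X,Y,Z) = g(K X Y, Z)] is symmetric in its first two arguments and skew in its last
    two; the two swaps generate all permutations and force [T = -T]. *)
Lemma symmetric_skew_eq0 (K : vectorField M -> vectorField M -> vectorField M) :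
  (forall X Y, K X Y = K Y X) ->
  (forall X Y Z, gm (K X Y) Z = - gm Y (K X Z)) ->
  forall X Y, K X Y = 0.
Proof.
move=> sym skew X Y; apply: (@metric_nondegenerate _ _ _ g) => Z.
have skew' U V W : gm (K U V) W = - gm (K U W) V by rewrite skew metricC.
apply: double_eq0.
(* [T(X,Y,Z) = -T(X,Z,Y) = -T(Z,X,Y) = T(Z,Y,X) = T(Y,Z,X) = -T(Y,X,Z) = -T(X,Y,Z)]. *)
by rewrite {1}skew' sym skew' (sym Z) opprK skew' (sym Y) addNr.
Qed.

Section KillingField.
Variable xi : vectorField M.
Hypothesis hkilling : killing g xi.

Lemma killingE X Y :
  xi (gm X Y) = (gm (lie_bracket xi X) Y + gm X (lie_bracket xi Y) :> C^oo(M)).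
Proof.
by apply/eqP; rewrite -subr_eq0 opprD addrA; apply/eqP; exact: hkilling.
Qed.

(** Both [nabla xi] and the bracket with [xi] obey a Leibniz rule on [g(X, Y)], so their difference
    [X |-> nabla X xi] is skew-adjoint. *)
Lemma killing_nabla_skew X Y : gm (nabla X xi) Y = - gm X (nabla Y xi).
Proof.
have [_ tf compat] := hnabla.
apply/eqP; rewrite -addr_eq0; apply/eqP.
have := killingE X Y; rewrite compat -!tf metricBl metricBr => /eqP.
rewrite -subr_eq0 => /eqP <-.
by move: (gm (nabla xi X) Y) (gm (nabla X xi) Y) (gm X (nabla xi Y))
  (gm X (nabla Y xi)) => *; ring.
Qed.

(* The difference of the two sides is symmetric in [X, Y] (torsion-freeness and
   Jacobi) and skew in its last argument for [g], hence vanishes. *)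
Lemma killing_lie_nabla X Y :
  lie_bracket xi (nabla X Y) =
  nabla (lie_bracket xi X) Y + nabla X (lie_bracket xi Y).
Proof.
have [_ tf compat] := hnabla.
pose K X Y := lie_bracket xi (nabla X Y) -
  (nabla (lie_bracket xi X) Y + nabla X (lie_bracket xi Y)).
apply/eqP; rewrite -subr_eq0; apply/eqP.
apply: (@symmetric_skew_eq0 K) => {X Y} [X Y|X Y Z].
  apply/eqP; rewrite -subr_eq0; apply/eqP.
  have BB (a b c d : vectorField M) : (a - b) - (c - d) = (a - c) - (b - d).
    by rewrite !opprD !opprK addrACA.
  rewrite /K BB -lie_bracketBr [nabla (lie_bracket xi Y) X + _]addrC.
  have DB (a b c d : vectorField M) : (a + b) - (c + d) = (a - c) + (b - d).
    by rewrite opprD addrACA.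
  rewrite DB !tf.
  by rewrite lie_bracket_jacobi subrr.
(* For skewness, expand the derivative of [g(Y, Z)] along [[xi, X]] twice: by compatibility of
   [nabla], and as a commutator of [xi] and [X]. The mixed terms cancel, leaving the skewness of
   [K X]. *)
have : (lie_bracket xi X (gm Y Z) : C^oo(M)) =
    (xi (X (gm Y Z)) : C^oo(M)) - X (xi (gm Y Z)) by [].
rewrite (compat (lie_bracket xi X)) (compat X) killingE !vfD !killingE !(compat X).
rewrite /K metricBl metricBr metricDl metricDr.
move: (gm _ _) (gm _ _) (gm _ _) (gm _ _) (gm _ _)
  (gm _ _) (gm _ _) (gm _ _) => b e a p q d c f /eqP.
rewrite -subr_eq0 => /eqP H; apply/eqP; rewrite -subr_eq0 -oppr_eq0 -H; apply/eqP.
ring.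
Qed.

Hypothesis hunit : gm xi xi = 1.

(** Differentiate the constant [g(xi, xi) = 1]. *)
Lemma unit_killing_orthogonal X : gm (nabla X xi) xi = 0.
Proof.
have [_ _ compat] := hnabla.
by apply: double_eq0; rewrite {2}metricC -compat hunit vf1.
Qed.

Lemma unit_killing_geodesic : nabla xi xi = 0.
Proof.
apply: (@metric_nondegenerate _ _ _ g) => Z.
by rewrite killing_nabla_skew metricC unit_killing_orthogonal oppr0.
Qed.

Lemma unit_killing_curvature X :
  curvature nabla X xi xi = - nabla (nabla X xi) xi.
Proof.
have [_ tf _] := hnabla.
have brxixi : lie_bracket xi xi = 0 by rewrite -tf subrr.
(* With [[xi, xi] = 0] and zero torsion this computes [nabla xi (nabla X xi)]; its term in [[xi, X]]
   cancels the bracket term of the curvature. *)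
have := killing_lie_nabla X xi.
rewrite brxixi nabla0r addr0 -tf => /eqP.
rewrite subr_eq => /eqP E.
rewrite /curvature unit_killing_geodesic nabla0r E sub0r.
rewrite (lie_bracketC xi X) nablaNl opprK opprD addrAC.
by rewrite addNr add0r.
Qed.

(** For skew-adjoint [A], the operator [-A^2] is [A] composed with its adjoint. *)
Lemma unit_killing_curvature_metric X Y :
  gm (curvature nabla X xi xi) Y = gm (nabla X xi) (nabla Y xi).
Proof. by rewrite unit_killing_curvature metricNl killing_nabla_skew opprK. Qed.

End KillingField.
End Killing.

(** * Construction and verification of the weak K-contact structure *)

Theorem theorem3p2 (R : realType) (n : nat)
    (M : smoothManifold R (2 * n)%N.+1) (g : riemannianMetric M)
    (nabla : vectorField M -> vectorField M -> vectorField M)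
    (hnabla : is_levi_civita g nabla)
    (xi : vectorField M)
    (hunit : metric g xi xi = 1)
    (hkilling : killing g xi)
    (hpos : positive_xi_sectional_curvature g nabla xi) :
  exists (phi Q : endoField M) (eta : oneForm M),
    [/\ forall X, eta X = metric g X xi,
        forall X, phi X = - nabla X xi,
        forall X, eta X = 0 -> Q X = curvature nabla X xi xi,
        Q xi = xi &
        weak_K_contact phi Q xi eta g].
Proof.
have [[lin _ _] tf compat] := hnabla.
pose A X := - nabla X xi.
have Alin : linear A.
  by move=> f X Y; rewrite /A lin opprD scalerN.
pose e X : (C^oo(M))^o := metric g X xi.
have elin : linear e by move=> f X Y; exact: metric_linearl.
(* The summand along [xi] vanishes on the kernel of [eta] and gives [xi] at [xi], where the
   curvature term is zero; both prescribed values of [Q] result. *)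
pose B X := curvature nabla X xi xi + metric g X xi *: xi.
(* This form yields linearity from that of [A], and is the identity for [phi^2]. *)
have BE X : B X = - A (A X) + metric g X xi *: xi.
  rewrite /B (unit_killing_curvature _ _ hnabla _ hkilling) //.
  by rewrite /A (nablaNl _ _ hnabla) opprK.
have Blin : linear B.
  move=> f X Y; rewrite !BE !Alin metric_linearl scalerDl -scalerA.
  by rewrite opprD scalerDr [f *: - A (A X)]scalerN addrACA.
pose phi : endoField M := HB.pack A (GRing.isLinear.Build _ _ _ _ A Alin).
pose Q : endoField M := HB.pack B (GRing.isLinear.Build _ _ _ _ B Blin).
pose eta : oneForm M := HB.pack e (GRing.isLinear.Build _ _ _ _ e elin).
have Qxi : Q xi = xi.
  rewrite [LHS]BE hunit scale1r /A (unit_killing_geodesic _ _ hnabla _ hkilling) //.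
  by rewrite oppr0 (nabla0l _ _ hnabla) !oppr0 add0r.
exists phi, Q, eta; split=> //.
  by move=> X eX; rewrite -[LHS]/(curvature nabla X xi xi + e X *: xi)
    [e X]eX scale0r addr0.
split; last exact: hkilling.
split; last first.
  move=> X Y.
  rewrite /fundamental_form /d_eta -[phi Y]/(- nabla Y xi) metricNr.
  rewrite -[eta Y]/(metric g Y xi) -[eta X]/(metric g X xi).
  rewrite -[eta (lie_bracket X Y)]/(metric g (lie_bracket X Y) xi).
  (* Zero torsion cancels the derivatives of [X] and [Y]; by skewness the rest is
     [-2 g(X, nabla Y xi)], and the factor 2 is absorbed by the one half in [d_eta]. *)
  rewrite !compat -tf metricBl [metric g Y (nabla X xi)]metricC.
  rewrite (killing_nabla_skew _ _ hnabla _ hkilling X Y).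
  apply: (scalerI (a := 2%:R : R)); first by rewrite pnatr_eq0.
  rewrite scalerA mulfV ?pnatr_eq0 // scale1r scaler_nat mulr2n.
  by move: (metric _ _ _) (metric _ _ _) (metric _ _ _) => *; ring.
split; last first.
  move=> X Y.
  rewrite -[phi X]/(- nabla X xi) -[phi Y]/(- nabla Y xi).
  rewrite -[Q Y]/(curvature nabla Y xi xi + metric g Y xi *: xi).
  rewrite -[eta X]/(metric g X xi) -[eta Y]/(metric g Y xi).
  rewrite metricNl metricNr opprK metricDr metricZr.
  rewrite [metric g X (curvature _ _ _ _)]metricC.
  rewrite (unit_killing_curvature_metric _ _ hnabla _ hkilling hunit).
  by rewrite [metric g (nabla Y xi) _]metricC [metric g Y xi * _]mulrC addrK.
split=> //.
- move=> p X QX0.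
  have Qp Y : metric g (Q X) Y p = 0 by rewrite /= QX0 metric_at0l.
  have QE Y : metric g (Q X) Y =
      metric g (nabla X xi) (nabla Y xi) + metric g X xi * metric g xi Y.
    rewrite metricDl metricZl.
    by rewrite (unit_killing_curvature_metric _ _ hnabla _ hkilling hunit).
  (* Pairing with [xi] isolates [eta X], as [nabla xi xi = 0]. *)
  have eX : metric g X xi p = 0.
    have := Qp xi; rewrite QE (unit_killing_geodesic _ _ hnabla _ hkilling hunit).
    by rewrite hunit mulr1 metricC metric0l add0r.
  have RX : metric g (curvature nabla X xi xi) X p = 0.
    have := Qp X; rewrite metricDl metricZl.
    move=> H; rewrite -[RHS]H.
    rewrite -[RHS]/(metric g (curvature nabla X xi xi) X p +
      metric g X xi p * metric g xi X p).
    by rewrite eX mul0r addr0.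
  apply/eqP/negP => /negP Xp.
  have xip : vf_at p xi != 0.
    apply/eqP => xi0; have := congr1 (fun h : C^oo(M) => h p) hunit.
    by rewrite /= xi0 metric_at0l => /esym/eqP; rewrite oner_eq0.
  have xi_span : exists a b : R, vf_at p xi = a *: vf_at p X + b *: vf_at p xi.
    by exists 0, 1; rewrite scale0r scale1r add0r.
  (* If [X] is nonzero at [p], then [X] and [xi], orthogonal by [eX], span a plane there. Its
     sectional curvature has numerator 0 by [RX], against positivity. *)
  have indep := orthogonal_linearly_independent _ _ _ _ Xp xip eX.
  have := hpos p X xi indep xi_span.
  by rewrite /sectional_curvature RX mul0r ltxx.
- by move=> X; rewrite -[Q X]/(B X) BE opprD opprK addrNK.
- move=> X _; rewrite -[LHS]/(metric g (- nabla X xi) xi) metricNl.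
  by rewrite (unit_killing_orthogonal _ _ hnabla _ hunit) oppr0.
Qed.
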